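(* Let $(V, e)$ be an order unit space with $\dim(V) \ge 2$. Then $V$ contains a copy of $\ell_\infty^2$ as an order unit subspace. Moreover, for $n \ge 2$, $V$ contains a copy of $\ell_\infty^n$ as an order unit subspace if and only if there exist $u_1, \dots, u_n \in R_V$ such that $u_i \perp_\infty u_j$ for all $i, j \in \{1, \dots, n\}$ with $i \neq j$, $\sum_{i=1}^n u_i = e$, and $\perp_\infty$ is additive in the linear span of $u_1, \dots, u_n$.
   Context: Order unit space: a real vector space $V$ with a proper Archimedean cone $V^+$ and an order unit $e \in V^+$, normed by $\Vert v \Vert = \inf\{k > 0 : ke \pm v \in V^+\}$. The periphery of $V$ is $R_V = \{u \in V^+ : \Vert u \Vert = 1 = \Vert e - u \Vert\}$. $\infty$-orthogonality: for $x, y$ in a real normed space, $x \perp_\infty y$ means $\Vert x + ky \Vert = \max\{\Vert x \Vert, \Vert ky \Vert\}$ for all $k \in \mathbb{R}$. ''$\perp_\infty$ is additive in the linear span of $u_1, \dots, u_n$'' means: $\left\Vert \sum_{i=1}^n \alpha_i u_i \right\Vert = \max\{\Vert \alpha_i u_i \Vert : 1 \le i \le n\}$ for all $\alpha_1, \dots, \alpha_n \in \mathbb{R}$. $\ell_\infty^n$ is $\mathbb{R}^n$ with coordinatewise order, order unit $(1, \dots, 1)$ and max norm. ''$V$ contains a copy of $\ell_\infty^n$ as an order unit subspace'' means: there is a linear subspace $W \subset V$ with $e \in W$ and a linear bijection $\Gamma : \ell_\infty^n \to W$ with $\Gamma(1, \dots, 1) = e$ such that $a \ge 0$ in $\ell_\infty^n$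 if and only if $\Gamma(a) \in V^+$. *)

(* Defs.v *)
From HB Require Import structures.
From mathcomp Require Import all_boot all_order all_algebra.
From mathcomp Require Import boolp classical_sets functions reals.

Set Implicit Arguments.
Unset Strict Implicit.
Unset Printing Implicit Defensive.

Import Order.TTheory GRing.Theory Num.Theory.

Local Open Scope classical_set_scope.
Local Open Scope ring_scope.

(* V may be infinite-dimensional, so its dimension is only bounded from below,
   through linearly independent families. *)
Definition dim_geq (R : realType) (V : lmodType R) (n : nat) : Prop :=
  exists v : 'I_n -> V, forall a : 'I_n -> R,
    \sum_(i < n) a i *: v i = 0 -> forall i, a i = 0.

Record proper_cone (R : realType) (V : lmodType R) (C : set V) : Prop := {
  cone0 : C 0;
  coneD : forall u v, C u -> C v -> C (u + v);
  coneZ : forall (k : R) v, 0 <= k -> C v -> C (k *: v);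
  cone_proper : forall v, C v -> C (- v) -> v = 0
}.

Definition archimedean_cone (R : realType) (V : lmodType R) (C : set V) : Prop :=
  forall u v, C u -> (forall k : R, 0 < k -> C (k *: u + v)) -> C v.

Definition order_unit (R : realType) (V : lmodType R) (C : set V) (e : V) : Prop :=
  C e /\ forall v, exists k : R, [/\ 0 < k, C (k *: e + v) & C (k *: e - v)].

Record order_unit_space (R : realType) (V : lmodType R) (C : set V) (e : V) :
    Prop := {
  ous_cone : proper_cone C;
  ous_archimedean : archimedean_cone C;
  ous_unit : order_unit C e
}.

Definition ou_norm (R : realType) (V : lmodType R) (C : set V) (e v : V) : R :=
  inf [set k : R | [/\ 0 < k, C (k *: e + v) & C (k *: e - v)]].

Definition periphery (R : realType) (V : lmodType R) (C : set V) (e : V) :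
    set V :=
  [set u | [/\ C u, ou_norm C e u = 1 & ou_norm C e (e - u) = 1]].

Definition orth_infty (R : realType) (V : lmodType R) (N : V -> R) (x y : V) :
    Prop :=
  forall k : R, N (x + k *: y) = Num.max (N x) (N (k *: y)).

(* The default value 0 of the maximum is harmless: the terms are norms. *)
Definition orth_infty_additive (R : realType) (V : lmodType R) (N : V -> R)
    (n : nat) (u : 'I_n -> V) : Prop :=
  forall a : 'I_n -> R,
    N (\sum_(i < n) a i *: u i) = \big[Num.max/0]_(i < n) N (a i *: u i).

Definition linfty_cone (R : realType) (n : nat) : set 'rV[R]_n :=
  [set a | forall i, 0 <= a 0 i].

Definition linfty_unit (R : realType) (n : nat) : 'rV[R]_n := const_mx 1.

Definition contains_linfty (R : realType) (V : lmodType R) (C : set V) (e : V)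
    (n : nat) : Prop :=
  exists (W : set V) (G : {linear 'rV[R]_n -> V}),
    [/\ submod_closed [in W] /\ W e,
        set_bij setT W G,
        G (linfty_unit R n) = e &
        forall a : 'rV[R]_n, linfty_cone a <-> C (G a)].

(* Main.v *)
Require Import Defs.
From HB Require Import structures.
From mathcomp Require Import all_boot all_order all_algebra.
From mathcomp Require Import boolp classical_sets functions reals.
From mathcomp Require Import lra.

Import Order.TTheory GRing.Theory Num.Theory.

Local Open Scope classical_set_scope.
Local Open Scope ring_scope.

(** An order unit subspace isomorphic to [l_infty^n] amounts to a family [u] with
    sum [e] whose combinations [\sum_i a_i u_i] are positive exactly when all [a_i]
    are nonnegative; call it an order basis of its span ([contains_linftyP]). The
    theorem compares this order condition with a norm condition.

    The bridge is that, by the Archimedean property, positivity passes to the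
    infimum that defines the norm [N]: for [k >= 0], [N v <= k] iff [k e + v] and
    [k e - v] are positive ([ou_norm_leP]).

    From order to norm: as [k e = \sum_i k u_i], positivity of
    [k e +- \sum_i a_i u_i] says [|a_i| <= k] for all [i], so the norm of
    [\sum_i a_i u_i] is the largest [|a_i|] ([ou_norm_order_basis]); the norm
    conditions on [u] are instances of this formula.

    From norm to order: if [x = \sum_i a_i u_i] is positive and [M = N x], then
    [M e - x] lies between [0] and [M e], hence has norm at most [M]. Its
    coordinates are [M - a_i], and the norm is the largest of their absolute
    values, so [|M - a_i| <= M] and [a_i >= 0] ([order_basis_of_additive]).

    For [n = 2], take [v] outside the line of [e] and the smallest [b] and largest
    [a] with [a e <= v <= b e]. Then [(v - a e) / (b - a)] and [(b e - v) / (b - a)]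
    are positive with sum [e], and the extremality of [a] and [b] makes them an
    order basis ([exists_order_basis2]). *)

(** * The order unit norm *)

Section OrderUnitSpace.
Context {R : realType} {V : lmodType R} {C : set V} {e : V}.
Hypothesis VCe : order_unit_space C e.

Let cone := ous_cone VCe.

Lemma cone_unit_closed {k : R} {v : V} :
  (forall d, 0 < d -> C ((k + d) *: e + v)) -> C (k *: e + v).
Proof.
move=> h; apply: (ous_archimedean VCe (u := e)); first by case: (ous_unit VCe).
by move=> d d0; rewrite addrA -scalerDl (addrC d); exact: h.
Qed.

Lemma cone_unit_mono {k l : R} {v : V} :
  k <= l -> C (k *: e + v) -> C (l *: e + v).
Proof.
move=> kl h.
have -> : l *: e + v = (l - k) *: e + (k *: e + v).
  by rewrite addrA -scalerDl subrK.
apply: (coneD cone) => //; apply: (coneZ cone); first by rewrite subr_ge0.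
by case: (ous_unit VCe).
Qed.

Let norm_set (v : V) : set R :=
  [set k : R | [/\ 0 < k, C (k *: e + v) & C (k *: e - v)]].

Let has_inf_norm_set v : has_inf (norm_set v).
Proof.
split; first by case: (ous_unit VCe) => _ /(_ v).
by exists 0 => k [/ltW].
Qed.

Lemma ou_norm_ge0 (v : V) : 0 <= ou_norm C e v.
Proof. by apply: lb_le_inf; [case: (has_inf_norm_set v)|move=> k [/ltW]]. Qed.

(** The cone is closed along the direction of [e], so positivity of [l e +- v]
    for [l] arbitrarily close to the norm persists at the norm itself. *)
Lemma ou_norm_leP {v : V} {k : R} : 0 <= k ->
  ou_norm C e v <= k <-> C (k *: e + v) /\ C (k *: e - v).
Proof.
move=> k0; split=> [Nk|[h1 h2]].
  suff h d : 0 < d -> C ((k + d) *: e + v) /\ C ((k + d) *: e - v).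
    by split; apply: cone_unit_closed => d /h[].
  move=> d0; have [l [l0 h1 h2] lN] := inf_adherent d0 (has_inf_norm_set v).
  have lk : l <= k + d by apply/ltW/(lt_le_trans lN); rewrite lerD2r.
  by split; apply: cone_unit_mono lk _.
apply/ler_addgt0Pr => d d0; apply: ge_inf; first by case: (has_inf_norm_set v).
have kd : k <= k + d by rewrite lerDl ltW.
by split; [rewrite ltr_wpDl|apply: cone_unit_mono kd _..].
Qed.

Lemma ou_normZ_le (a : R) (v : V) :
  ou_norm C e (a *: v) <= `|a| * ou_norm C e v.
Proof.
have [h1 h2] := (ou_norm_leP (ou_norm_ge0 v)).1 (lexx _).
apply/ou_norm_leP; first by rewrite mulr_ge0 ?ou_norm_ge0.
have [a0|/ltW a0] := leP 0 a.
  rewrite ger0_norm // -scalerA -scalerDr -scalerBr.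
  by split; apply: (coneZ cone).
rewrite ler0_norm // -[a *: v]opprK -scaleNr opprK -scalerA -scalerBr -scalerDr.
by split; apply: (coneZ cone); rewrite ?oppr_ge0.
Qed.

Lemma ou_normZ (a : R) (v : V) : ou_norm C e (a *: v) = `|a| * ou_norm C e v.
Proof.
apply/eqP; rewrite eq_le ou_normZ_le /=.
have [->|a0] := eqVneq a 0; first by rewrite normr0 mul0r ou_norm_ge0.
have := ou_normZ_le a^-1 (a *: v).
by rewrite scalerA mulVf // scale1r normfV ler_pdivlMl ?normr_gt0.
Qed.

(** * Order bases *)

Definition order_basis {n} (u : 'I_n -> V) : Prop :=
  \sum_i u i = e /\
  forall a : 'I_n -> R, (forall i, 0 <= a i) <-> C (\sum_i a i *: u i).

Definition lincomb {n} (u : 'I_n -> V) (a : 'rV[R]_n) : V :=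
  \sum_i a 0 i *: u i.

Lemma lincomb_is_linear {n} (u : 'I_n -> V) : linear (lincomb u).
Proof.
move=> k a b; rewrite /lincomb scaler_sumr -big_split; apply: eq_bigr => i _.
by rewrite !mxE scalerDl scalerA.
Qed.

HB.instance Definition _ n (u : 'I_n -> V) :=
  GRing.isLinear.Build R 'rV[R]_n V *:%R (lincomb u) (lincomb_is_linear u).

(** Bijectivity onto the range comes for free: a linear map that reflects
    positivity has trivial kernel, since the cone of [l_infty^n] is proper. *)
Lemma contains_linftyP n :
  contains_linfty C e n <-> exists u : 'I_n -> V, order_basis u.
Proof.
split=> [[W [G [_ _ G1 GC]]]|[u [u1 uC]]].
  have GE (a : 'I_n -> R) :
      \sum_i a i *: G (delta_mx 0 i) = G (\row_i a i).
    rewrite (row_sum_delta (\row_i a i)) linear_sum.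
    by apply: eq_bigr => i _; rewrite linearZ mxE.
  exists (fun i => G (delta_mx 0 i)); split=> [|a].
    rewrite -{}G1; transitivity (\sum_i (1 : R) *: G (delta_mx 0 i)).
      by apply: eq_bigr => i _; rewrite scale1r.
    by rewrite GE; congr (G _); apply/rowP => i; rewrite !mxE.
  by rewrite GE -GC; split=> h i; have := h i; rewrite mxE.
have linC (a : 'rV[R]_n) : linfty_cone a <-> C (lincomb u a) by exact: uC.
have lin1 : lincomb u (linfty_unit R n) = e.
  by rewrite -u1; apply: eq_bigr => i _; rewrite mxE scale1r.
exists (range (lincomb u)), (lincomb u); split => //.
  split; last by exists (linfty_unit R n).
  split=> [|k x y /set_mem[a _ <-] /set_mem[b _ <-]]; apply/mem_set.
    by exists 0; rewrite ?linear0.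
  by exists (k *: a + b); rewrite ?linearP.
split=> // a b _ _ ab; apply/subr0_eq/rowP => i.
have ab0 : lincomb u (a - b) = 0 by rewrite linearB /= ab subrr.
have h1 : linfty_cone (a - b) by apply/linC; rewrite ab0; exact: cone0 cone.
have h2 : linfty_cone (- (a - b)).
  by apply/linC; rewrite linearN /= ab0 oppr0; exact: cone0 cone.
by move: (h1 i) (h2 i); rewrite !mxE; lra.
Qed.

(** * From the order to the norm *)

Lemma ou_norm_order_basis_le {n} {u : 'I_n -> V} {a : 'I_n -> R} {k : R} :
  order_basis u -> 0 <= k ->
  ou_norm C e (\sum_i a i *: u i) <= k <-> forall i, `|a i| <= k.
Proof.
case=> u1 uC k0; rewrite ou_norm_leP // -u1 scaler_sumr -big_split -sumrB /=.
under eq_bigr do rewrite -scalerDl.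
under [X in _ /\ C X <-> _]eq_bigr do rewrite -scalerBl.
rewrite -!uC; split=> [[h1 h2] i|h].
  by rewrite ler_norml lerNl; move: (h1 i) (h2 i); lra.
by split=> i; move: (h i); rewrite ler_norml => /andP[]; lra.
Qed.

Lemma ou_norm_order_basis {n} (u : 'I_n -> V) (a : 'I_n -> R) :
  order_basis u ->
  ou_norm C e (\sum_i a i *: u i) = \big[Num.max/0]_i `|a i|.
Proof.
move=> hu; apply/eqP; rewrite eq_le; apply/andP; split.
  apply/ou_norm_order_basis_le => // [|i]; first exact: bigmax_ge_id.
  exact: (le_bigmax _ (fun i => `|a i|)).
apply/bigmax_leP; split=> [|i _]; first exact: ou_norm_ge0.
exact: (ou_norm_order_basis_le hu (ou_norm_ge0 _)).1 (lexx _) i.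
Qed.

Lemma sum_delta {n} (u : 'I_n -> V) j : \sum_i ((i == j)%:R : R) *: u i = u j.
Proof.
rewrite (bigD1 j) //= eqxx scale1r big1 ?addr0 // => i /negPf ->.
by rewrite scale0r.
Qed.

Lemma order_basis_norm1 {n} (u : 'I_n -> V) j :
  order_basis u -> ou_norm C e (u j) = 1.
Proof.
move=> hu; rewrite -(sum_delta u) ou_norm_order_basis //.
apply/eqP; rewrite eq_le; apply/andP; split.
  by apply/bigmax_leP; split=> // i _; case: (i == j); rewrite ?normr1 ?normr0.
by apply: (bigmax_sup j) => //; rewrite eqxx normr1.
Qed.

Lemma order_basis_periphery {n} (u : 'I_n -> V) j :
  (2 <= n)%N -> order_basis u -> periphery C e (u j).
Proof.
move=> n2 hu; have [u1 uC] := hu; split; last 1 first.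
- have -> : e - u j = \sum_i (1 - (i == j)%:R : R) *: u i.
    rewrite -[in LHS]u1 -[X in _ - X](sum_delta u) -sumrB.
    by apply: eq_bigr => i _; rewrite scalerBl scale1r.
  rewrite ou_norm_order_basis //; apply/eqP; rewrite eq_le; apply/andP; split.
    apply/bigmax_leP; split=> // i _.
    by case: (i == j); rewrite ?subrr ?subr0 ?normr1 ?normr0.
  (* the norm is reached at a second index: for n = 1, e - u j would be 0 *)
  have [i ij] : exists i, i != j.
    have : (0 < #|predC1 j|)%N.
      by rewrite cardC1 card_ord; case: n n2 {u j hu u1 uC} => [|[]].
    by case/card_gt0P => i; rewrite inE; exists i.
  by apply: (bigmax_sup i) => //; rewrite (negPf ij) subr0 normr1.
- by rewrite -(sum_delta u); apply/uC => i; case: (i == j).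
- exact: order_basis_norm1.
Qed.

Lemma order_basis_orth {n} (u : 'I_n -> V) i j :
  i != j -> order_basis u -> orth_infty (ou_norm C e) (u i) (u j).
Proof.
move=> ij hu k; rewrite ou_normZ !order_basis_norm1 // mulr1.
have -> : u i + k *: u j = \sum_l ((l == i)%:R + k * (l == j)%:R) *: u l.
  rewrite -{1}(sum_delta u i) -{1}(sum_delta u j) scaler_sumr -big_split.
  by apply: eq_bigr => l _; rewrite scalerDl scalerA.
rewrite ou_norm_order_basis //; apply/eqP; rewrite eq_le; apply/andP; split.
  apply/bigmax_leP; split=> [|l _]; first by rewrite le_max ler01.
  have [->|li] := eqVneq l i.
    by rewrite (negPf ij) mulr0 addr0 normr1 le_max lexx.
  case: (l == j); first by rewrite add0r mulr1 le_max lexx orbT.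
  by rewrite mulr0 addr0 normr0 le_max ler01.
rewrite ge_max; apply/andP; split.
  by apply: (bigmax_sup i) => //; rewrite eqxx (negPf ij) mulr0 addr0 normr1.
apply: (bigmax_sup j) => //.
by rewrite eqxx eq_sym (negPf ij) add0r mulr1.
Qed.

Lemma order_basis_additive {n} (u : 'I_n -> V) :
  order_basis u -> orth_infty_additive (ou_norm C e) u.
Proof.
move=> hu a; rewrite ou_norm_order_basis //; apply: eq_bigr => i _.
by rewrite ou_normZ order_basis_norm1 // mulr1.
Qed.

(** * From the norm to the order *)

(** A positive [x] of norm [M] satisfies [0 <= M e - x <= M e], so [M e - x] has
    norm at most [M]; additivity turns this into [|M - a_i| <= M] for the
    coordinates [a_i] of [x]. *)
Lemma order_basis_of_additive {n} (u : 'I_n -> V) :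
  (forall i, C (u i)) -> (forall i, ou_norm C e (u i) = 1) ->
  \sum_i u i = e -> orth_infty_additive (ou_norm C e) u -> order_basis u.
Proof.
move=> uC uN u1 uadd; split=> // a; split=> [a0|aC].
  apply: (big_ind C) => [||i _]; [exact: cone0 cone|exact: coneD cone|].
  exact: (coneZ cone).
set x := \sum_i _ in aC; set M := ou_norm C e x.
have M0 : 0 <= M := ou_norm_ge0 x.
have [_ Mx] := (ou_norm_leP M0).1 (lexx _).
have : ou_norm C e (M *: e - x) <= M.
  apply/ou_norm_leP => //; split; last by rewrite subKr.
  apply: (coneD cone) => //; apply: (coneZ cone) => //.
  by case: (ous_unit VCe).
have -> : M *: e - x = \sum_i (M - a i) *: u i.
  rewrite -u1 scaler_sumr -sumrB.
  by apply: eq_bigr => i _; rewrite scalerBl.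
rewrite uadd => /bigmax_leP[_ h] i.
by move: (h i isT); rewrite ou_normZ uN mulr1 ler_norml => /andP[]; lra.
Qed.

(** * Two-dimensional order unit subspaces *)

Lemma exists_not_unit_multiple :
  dim_geq V 2 -> exists v : V, forall k : R, v <> k *: e.
Proof.
case=> w wfree; apply: contrapT => /forallNP noV.
have inE v : exists k : R, v = k *: e.
  by apply: contrapT => h; apply: (noV v) => k vk; apply: h; exists k.
have [a wa] := inE (w ord0); have [b wb] := inE (w (lift ord0 ord0)).
have : \sum_(i < 2) (if i == ord0 then b else - a) *: w i = 0.
  rewrite big_ord_recl big_ord1 /= wa wb !scalerA.
  by rewrite mulNr (mulrC b) -scalerDl subrr scale0r.
move=> /wfree/(_ (lift ord0 ord0))/= /eqP; rewrite oppr_eq0 => /eqP a0.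
have : \sum_(i < 2) ((i == ord0)%:R : R) *: w i = 0.
  by rewrite sum_delta wa a0 scale0r.
by move=> /wfree/(_ ord0)/= /eqP; rewrite oner_eq0.
Qed.

Lemma cone_unit_mult_ge0 {k : R} : e <> 0 -> C (k *: e) -> 0 <= k.
Proof.
move=> e0 ke; rewrite leNgt; apply/negP => k0; apply: e0.
apply: (cone_proper cone); first by case: (ous_unit VCe).
have -> : - e = (- k)^-1 *: (k *: e).
  by rewrite scalerA invrN mulNr mulVf ?scaleN1r // lt_eqF.
by apply: (coneZ cone) => //; rewrite invr_ge0 oppr_ge0 ltW.
Qed.

Lemma unit_neq0 (v : V) : v <> 0 -> e <> 0.
Proof.
move=> v0 e0; apply: v0.
have [_ /(_ v)[k []]] := ous_unit VCe.
by rewrite e0 scaler0 add0r sub0r => _; exact: cone_proper cone v.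
Qed.

(** The least [b] with [v <= b e]; its existence again rests on the Archimedean
    property. *)
Lemma exists_least_unit_bound (v : V) : e <> 0 ->
  exists b : R, forall k, b <= k <-> C (k *: e - v).
Proof.
move=> e0; pose S := [set k : R | C (k *: e - v)].
have [l [_ lp lm]] := (ous_unit VCe).2 v.
have Sinf : has_inf S.
  split; first by exists l.
  exists (- l) => k /= kv; suff: 0 <= l + k by lra.
  apply: cone_unit_mult_ge0 => //.
  have -> : (l + k) *: e = (l *: e + v) + (k *: e - v).
    by rewrite addrACA subrr addr0 scalerDl.
  exact: (coneD cone).
exists (inf S) => k; split=> [Sk|kv]; last by apply: ge_inf => //; case: Sinf.
apply: cone_unit_closed => d d0; have [m mS md] := inf_adherent d0 Sinf.
by apply: cone_unit_mono mS; apply/ltW/(lt_le_trans md); rewrite lerD2r.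
Qed.

Lemma exists_order_basis2 :
  dim_geq V 2 -> exists u : 'I_2 -> V, order_basis u.
Proof.
move=> /exists_not_unit_multiple[v vNe].
have e0 : e <> 0 by apply: (unit_neq0 v); have := vNe 0; rewrite scale0r.
have [b bP] := exists_least_unit_bound v e0.
have [a aP] : exists a : R, forall k, k <= a <-> C (v - k *: e).
  have [c cP] := exists_least_unit_bound (- v) e0.
  by exists (- c) => k; rewrite lerNr cP opprK scaleNr addrC.
have va : C (v - a *: e) by apply/aP.
have bv : C (b *: e - v) by apply/bP.
have ab : a < b.
  have ab_le : a <= b.
    rewrite -subr_ge0; apply: cone_unit_mult_ge0 => //.
    have -> : (b - a) *: e = (b *: e - v) + (v - a *: e).
      by rewrite addrA subrK scalerBl.
    exact: (coneD cone).
  rewrite lt_neqAle ab_le andbT; apply/eqP => abE; apply: (vNe a).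
  apply/subr0_eq/(cone_proper cone) => //.
  by rewrite opprB abE.
pose d := b - a; have d0 : 0 < d by rewrite subr_gt0.
have sumE (s t : R) :
    s *: (v - a *: e) + t *: (b *: e - v) = (t * b - s * a) *: e + (s - t) *: v.
  rewrite !scalerBr !scalerBl !scalerA [LHS]addrC [LHS]addrACA [RHS]addrACA.
  by congr (_ + _); rewrite addrC.
exists (fun i => d^-1 *: if i == ord0 then v - a *: e else b *: e - v).
split=> [|f].
  rewrite -scaler_sumr big_ord_recl big_ord1 /= addrC addrA subrK -scalerBl.
  by rewrite scalerA mulVf ?scale1r // gt_eqF.
rewrite big_ord_recl big_ord1 /=.
set s := f ord0; set t := f _.
rewrite 2![_ *: (d^-1 *: _)]scalerA.
split=> [f0|].
  apply: (coneD cone); apply: (coneZ cone) => //.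
    by rewrite mulr_ge0 ?f0 // invr_ge0 ltW.
  by rewrite mulr_ge0 ?f0 // invr_ge0 ltW.
move=> /(coneZ cone (ltW d0)).
rewrite scalerDr !scalerA !(mulrC d) !divfK ?gt_eqF // sumE => stC.
suff [s0 t0] : 0 <= s /\ 0 <= t.
  move=> i; case: (unliftP ord0 i) => [j ->|->] //.
  by rewrite (ord1 j).
(* dividing by |s - t| compares v with a multiple of e, to which the
   extremality of a or b applies *)
have [st|ts|st] := ltrgtP s t.
- have ts0 : 0 < t - s by rewrite subr_gt0.
  have : b <= (t * b - s * a) / (t - s).
    apply/bP.
    have -> : ((t * b - s * a) / (t - s)) *: e - v =
              (t - s)^-1 *: ((t * b - s * a) *: e + (s - t) *: v).
      rewrite scalerDr !scalerA mulrC -(opprB t s) mulrN mulVf ?gt_eqF //.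
      by rewrite scaleN1r.
    by apply: (coneZ cone) => //; rewrite invr_ge0 ltW.
  rewrite ler_pdivlMr // => h.
  suff s0 : 0 <= s by split => //; lra.
  by rewrite -(pmulr_lge0 _ d0) /d; lra.
- have st0 : 0 < s - t by rewrite subr_gt0.
  have : (s * a - t * b) / (s - t) <= a.
    apply/aP.
    have -> : v - ((s * a - t * b) / (s - t)) *: e =
              (s - t)^-1 *: ((t * b - s * a) *: e + (s - t) *: v).
      rewrite scalerDr !scalerA mulVf ?gt_eqF // scale1r addrC -scaleNr.
      by congr (_ *: _ + _); rewrite -mulNr opprB mulrC.
    by apply: (coneZ cone) => //; rewrite invr_ge0 ltW.
  rewrite ler_pdivrMr // => h.
  suff t0 : 0 <= t by split => //; lra.
  by rewrite -(pmulr_lge0 _ d0) /d; lra.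
- move: stC; rewrite st subrr scale0r addr0 => /(cone_unit_mult_ge0 e0).
  by rewrite -mulrBr pmulr_lge0.
Qed.

End OrderUnitSpace.

Theorem theorem5p3 (R : realType) (V : lmodType R) (C : set V) (e : V)
    (VCe : order_unit_space C e) (dimV : dim_geq V 2) :
  contains_linfty C e 2 /\
  forall n : nat, (2 <= n)%N ->
    (contains_linfty C e n <->
     exists u : 'I_n -> V,
       [/\ forall i, periphery C e (u i),
           forall i j, i != j -> orth_infty (ou_norm C e) (u i) (u j),
           \sum_(i < n) u i = e &
           orth_infty_additive (ou_norm C e) u]).
Proof.
split; first by apply/(contains_linftyP VCe)/(exists_order_basis2 VCe).
move=> n n2; rewrite (contains_linftyP VCe); split=> -[u].
  move=> hu; exists u; split.
  - by move=> i; exact: order_basis_periphery.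
  - by move=> i j ij; exact: order_basis_orth.
  - by case: hu.
  - exact: order_basis_additive.
case=> uR _ u1 uadd; exists u; apply: order_basis_of_additive => // i.
  by case: (uR i).
by case: (uR i).
Qed.
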